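(* Let $\mathcal{R}$ be the set of real numbers $q$ such that $\mathrm{Rel}(G;q)=0$ for some connected simple graph $G$. Then the topological closure of $\mathcal{R}$ in $\mathbb{R}$ is $\overline{\mathcal{R}}=[-1,0]\cup\{1\}$.
   Context: For a connected finite graph $G$ with vertex set $V(G)$ and edge set $E(G)$, the all-terminal reliability polynomial is $\mathrm{Rel}(G;q)=\sum_{A}(1-q)^{|A|}q^{|E(G)|-|A|}$, where the sum runs over all subsets $A\subseteq E(G)$ such that the spanning subgraph $(V(G),A)$ is connected. A real root of $\mathrm{Rel}(G;q)$ is called a real reliability root of $G$. *)

(* Defs.v *)
From HB Require Import structures.
From mathcomp Require Import all_boot all_order all_algebra.
From mathcomp Require Import all_classical all_reals all_analysis.
Set Implicit Arguments. Unset Strict Implicit. Unset Printing Implicit Defensive.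
Import Order.TTheory GRing.Theory Num.Theory.

(* A finite simple graph on vertex set 'I_n is given by its edge set E,
   a set of 2-element subsets of 'I_n. *)
Definition simple_edges (n : nat) (E : {set {set 'I_n}}) : bool :=
  [forall e in E, #|e| == 2].

Definition adj (n : nat) (A : {set {set 'I_n}}) : rel 'I_n :=
  fun x y => (x != y) && ([set x; y] \in A).

Definition connectedb (n : nat) (A : {set {set 'I_n}}) : bool :=
  (0 < n)%N && [forall x, forall y, connect (adj A) x y].

Local Open Scope ring_scope.

Definition Rel (R : pzRingType) (n : nat) (E : {set {set 'I_n}}) (q : R) : R :=
  \sum_(A in powerset E | connectedb A) (1 - q) ^+ #|A| * q ^+ (#|E| - #|A|).

Definition rel_roots (R : realType) : set R :=
  [set q | exists (n : nat) (E : {set {set 'I_n}}),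
      [/\ simple_edges E, connectedb E & Rel E q = 0]].

(* Main.v *)
(* Put r = 1/q - 1 and, for a set S of vertices, let Z(S) be the sum of r^|A|
   over the edge sets A that connect S, so that Rel(G; q) = q^|E| Z(V). With
   W(S) = (1 + r)^|E(S)|, decomposing A into the component of v and the rest
   gives W(v + S) = sum_(X <= S) Z(v + X) W(S \ X), from which W can be
   eliminated:
     Z(v + w + S) = sum_(X <= S)
       Z(w + X) ((1 + r)^deg(v, w + X) - 1) Z(v + (S \ X)).

   If |q| > 1 then |1 + r| < 1, the middle factor is <= 0, and by induction
   Z(S) has sign (-1)^(|S| - 1) and is nonzero when S is connected; for
   0 < q < 1 all terms of Rel are nonnegative. So the roots lie in
   [-1, 0] and {1}.

   For density, glue m copies of the complete graph K_n in a chain,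
   and join both ends of the chain to a new vertex. If C is the reliability of
   K_n, and S the weight of its configurations with two components separating
   the two terminals, the reliability of this graph is, up to a factor without
   zeros in (-1, 0), C^(m-1) ((1 + q) C + (1 - q) m S). As n grows, C -> 1 and
   S ~ 2 q^(n-1), negative for n even, so that m can be chosen to create a sign
   change between any two given points of (-1, 0). *)

Require Import Defs.
From HB Require Import structures.
From mathcomp Require Import all_boot all_order all_algebra.
From mathcomp Require Import ring lra zify.
Set Implicit Arguments. Unset Strict Implicit. Unset Printing Implicit Defensive.
Import Order.TTheory GRing.Theory Num.Theory.
Local Open Scope ring_scope.

(** * Convolution of set functions *)

Section Convolution.
Variables (T : finType) (R : comNzRingType).
Implicit Types (f g h : {set T} -> R) (S X Y Z : {set T}) (v w : T).

(** This is multiplication of multilinear generating functions, with one variable of square zero per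
    element of [T]. On sets that avoid [v], [shift v] acts as the partial derivative in the variable
    of [v]. *)
Definition conv f g S := \sum_(X : {set T} | X \subset S) f X * g (S :\: X).

Definition shift v f X := f (v |: X).

Lemma eq_conv f f' g g' S :
    (forall X, X \subset S -> f X = f' X) ->
    (forall X, X \subset S -> g X = g' X) ->
  conv f g S = conv f' g' S.
Proof.
by move=> Hf Hg; apply: eq_bigr => X XS; rewrite Hf // Hg // subsetDl.
Qed.

Lemma convC f g S : conv f g S = conv g f S.
Proof.
rewrite /conv (reindex_onto (fun X => S :\: X) (fun X => S :\: X)) /=; last first.
  by move=> X XS; rewrite setDDr setDv set0U; apply/setIidPr.
apply: eq_big => [X|X XS].
  rewrite subsetDl /= setDDr setDv set0U.
  by apply/eqP/idP => [<-|/setIidPr //]; rewrite subsetIl.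
by rewrite mulrC setDDr setDv set0U; case/andP: XS => _ /eqP; rewrite setDDr setDv set0U => ->.
Qed.

Lemma convA f g h S : conv f (conv g h) S = conv (conv f g) h S.
Proof.
rewrite /conv; under [RHS]eq_bigr => Z _ do rewrite mulr_suml.
rewrite (exchange_big_dep (fun X => X \subset S)) /=; last first.
  by move=> Z X ZS XZ; apply: subset_trans ZS.
apply: eq_bigr => X XS; rewrite mulr_sumr.
rewrite [RHS](reindex_onto (fun Y => X :|: Y) (fun Z => Z :\: X)) /=; last first.
  by move=> Z /andP[_ XZ]; rewrite -[RHS](setID Z X) (setIidPr XZ).
apply: eq_big => [Y|Y].
  rewrite setDUl setDv set0U subUset XS subsetUl andbT /=.
  by rewrite subsetD; congr (_ && _); apply/setDidPl/eqP.
rewrite subsetD => /andP[YS dYX].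
rewrite setDUl setDv set0U (setDidPl dYX) mulrA; congr (_ * _ * h _).
by apply/setP => x; rewrite !inE negb_or andbA [X in X && _]andbC.
Qed.

Lemma big_subset_setU1 v S (F : {set T} -> R) : v \notin S ->
  \sum_(X : {set T} | X \subset v |: S) F X =
  \sum_(X : {set T} | X \subset S) F (v |: X) +
  \sum_(X : {set T} | X \subset S) F X.
Proof.
move=> vS; rewrite (bigID (fun X : {set T} => v \in X)) /=; congr (_ + _).
  rewrite (reindex_onto (fun X => v |: X) (fun X => X :\ v)) /=; last first.
    by move=> X /andP[_]; apply: setD1K.
  apply: eq_bigl => X; rewrite setU11 andbT; apply/andP/idP => [[XS /eqP E]|XS].
    have vX : v \notin X by rewrite -E !inE eqxx.
    apply/subsetP => x xX; have := subsetP XS x.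
    rewrite !inE xX orbT => /(_ isT) /orP[/eqP xv|//].
    by rewrite -xv xX in vX.
  split; first exact: setUS.
  by apply/eqP/setU1K; apply: contra vS; apply: subsetP.
apply: eq_bigl => X; apply/andP/idP => [[XS vX]|XS].
  apply/subsetP => x xX; have := subsetP XS x xX.
  by rewrite !inE => /orP[/eqP xv|//]; rewrite -xv xX in vX.
split; first by apply: subset_trans XS (subsetUr _ _).
by apply: contra vS; apply: subsetP.
Qed.

Lemma conv_setU1 v f g S : v \notin S ->
  conv f g (v |: S) = conv (shift v f) g S + conv f (shift v g) S.
Proof.
move=> vS; rewrite /conv big_subset_setU1 //; congr (_ + _); apply: eq_bigr => X XS.
  congr (_ * g _); apply/setP => x; rewrite !inE negb_or.
  by case: eqP => [->|//] /=; rewrite (negPf vS) andbF.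
rewrite /shift; congr (_ * g _); apply/setP => x; rewrite !inE.
case: eqP => [->|//] /=; rewrite andbT; apply/negP.
by move/(subsetP XS); apply/negP.
Qed.

(** Induction on the size of [S]: since [h set0 = 1], the term [X = S] of the convolution is [f S]
    itself, and all other terms involve smaller sets. *)
Lemma conv_cancel f g h S : h set0 = 1 ->
  (forall X, X \subset S -> conv f h X = conv g h X) -> f S = g S.
Proof.
move=> h0; have [n] := ubnP #|S|; elim: n S => // n IH S ltn H.
have := H S (subxx _); rewrite /conv (bigD1 S) //= [in RHS](bigD1 S) //=.
rewrite setDv h0 !mulr1 => /eqP; rewrite -subr_eq -addrA => /eqP <-.
rewrite -[LHS]addr0; congr (_ + _); apply/esym/eqP; rewrite subr_eq0; apply/eqP.
apply: eq_bigr => X XS; congr (_ * _). apply: IH.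
  by rewrite -ltnS; apply: leq_trans ltn; rewrite ltnS proper_card // properEneq andbC.
move=> Y YX; apply: H; case/andP: XS => XS _; exact: subset_trans XS.
Qed.

(* The Leibniz rule [conv_setU1] and cancellation of [W] turn the two
   expressions of [W (v |: (w |: S))] into a recursion for [z]. *)
Lemma log_recursion (W z m : {set T} -> R) v w S :
    W set0 = 1 ->
    (forall x X, x \notin X -> W (x |: X) = conv (shift x z) W X) ->
    (forall X, v \notin X -> W (v |: X) = m X * W X) ->
    (forall X Y, [disjoint X & Y] -> m (X :|: Y) = m X * m Y) ->
    v != w -> v \notin S -> w \notin S ->
  z (v |: (w |: S)) =
  \sum_(X : {set T} | X \subset S)
     z (w |: X) * (m (w |: X) - 1) * z (v |: (S :\: X)).
Proof.
move=> W0 Wz Wm mU vw vS wS.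
pose zw X := m (w |: X) * z (w |: X).
pose zvw X := z (v |: (w |: X)).
pose k X := z (w |: X) * (m (w |: X) - 1).
suff H X : X \subset S -> conv zvw W X = conv (conv k (shift v z)) W X.
  exact: (conv_cancel W0 H).
move=> XS.
have vX : v \notin X by apply: contra vS; apply: subsetP.
have wX : w \notin X by apply: contra wS; apply: subsetP.
have vwX : v \notin w |: X by rewrite !inE negb_or vw.
(* [E1] decomposes at the cluster of [v] and then applies the Leibniz rule in [w]. [E3] first
   extracts [v] as a factor [m], decomposes at the cluster of [w], and lets the part of [m] outside
   that cluster put [v] back into the remaining set. *)
have E1 : W (v |: (w |: X)) = conv zvw W X + conv (shift v z) (shift w W) X.
  by rewrite (Wz v) // conv_setU1.
have E2 : conv (shift v z) (shift w W) X = conv (shift w z) (conv (shift v z) W) X.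
  rewrite (eq_conv (f' := shift v z) (g' := conv (shift w z) W)) //; last first.
    by move=> Y YX; rewrite /shift (Wz w) //; apply: contra wX; apply: subsetP.
  by rewrite !convA; apply: eq_bigr => Y _; rewrite convC.
have E3 : W (v |: (w |: X)) = conv zw (conv (shift v z) W) X.
  rewrite Wm // (Wz w) // /conv mulr_sumr; apply: eq_bigr => Y YX.
  have -> : m (w |: X) = m (w |: Y) * m (X :\: Y).
    rewrite -mU; last first.
      rewrite disjoint_sym disjoints_subset; apply/subsetP => x; rewrite !inE.
      by case: eqP => [->|_]; [rewrite (negPf wX) andbF|case/andP].
    by congr m; rewrite -setUA -[in LHS](setID X Y) (setIidPr YX).
  have vXY : v \notin X :\: Y by rewrite !inE (negPf vX) andbF.
  rewrite -/(conv (shift v z) W (X :\: Y)) -(Wz v) // Wm // /zw /shift.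
  by rewrite mulrACA.
have -> : conv zvw W X = conv zw (conv (shift v z) W) X - conv (shift w z) (conv (shift v z) W) X.
  by rewrite -E3 E1 -E2 addrK.
rewrite -convA /conv -sumrB; apply: eq_bigr => Y YX.
by rewrite -mulrBl /k /zw /shift mulrBr mulr1 [m _ * _]mulrC.
Qed.

End Convolution.

(** * Sums over connected edge sets *)

Section Clusters.
Variable n : nat.
Implicit Types (A E : {set {set 'I_n}}) (S U X Y P Q : {set 'I_n}) (v w : 'I_n).

Definition edges_in E S := [set e in E | e \subset S].

(** Paths are not confined to [S] here; the condition [A \subset edges_in E S] in [connected_sum]
    confines them. *)
Definition spans A S := [forall x in S, forall y in S, connect (adj A) x y].

Definition component A v := [set x | connect (adj A) v x].

Lemma adj_sym A : symmetric (adj A).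
Proof. by move=> x y; rewrite /adj eq_sym setUC. Qed.

Lemma connect_adj_sym A : connect_sym (adj A).
Proof. exact/sym_connect_sym/adj_sym. Qed.

Lemma connect_adj_mono A A' x y : A \subset A' ->
  connect (adj A) x y -> connect (adj A') x y.
Proof.
move=> AA'; apply: connect_sub => {}x {}y /andP[xy xyA].
by rewrite connect1 // /adj xy (subsetP AA').
Qed.

Lemma connect_adj_stable A U x y :
    (forall a b, adj A a b -> a \in U -> b \in U) ->
  connect (adj A) x y -> x \in U -> y \in U.
Proof.
move=> H /(closed_connect (a := mem U)) <- //.
by apply: (intro_closed (connect_adj_sym A)).
Qed.

Lemma spansP A v S : v \in S ->
  reflect (forall x, x \in S -> connect (adj A) v x) (spans A S).
Proof.
move=> vS; apply: (iffP forall_inP) => [H x xS|H x xS].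
  by have /forall_inP := H v vS; apply.
apply/forall_inP => y yS; apply: connect_trans (H y yS).
by rewrite connect_adj_sym H.
Qed.

Lemma mem_edges_in E S x y :
  ([set x; y] \in edges_in E S) = [&& [set x; y] \in E, x \in S & y \in S].
Proof. by rewrite inE subUset !sub1set. Qed.

(** A path from [v] never leaves the component of [v], so it only uses edges with both ends in
    [U]. *)
Lemma spans_component E A v U S :
    A \subset edges_in E S -> component A v = U -> v \in U ->
  spans (A :&: edges_in E U) U.
Proof.
move=> AE compU vU; apply/(spansP _ vU) => x.
rewrite -{1}compU inE => vx.
have := connect_adj_stable (U := component (A :&: edges_in E U) v) _ vx.
rewrite !inE connect0; apply=> // a b /andP[ab abA]; rewrite !inE => va.
apply: (connect_trans va); apply: connect1; rewrite /adj ab inE abA mem_edges_in.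
have aU : a \in U by rewrite -compU inE; apply: connect_adj_mono va; apply: subsetIl.
have bU : b \in U.
  by move: aU; rewrite -compU !inE => /connect_trans; apply; rewrite connect1 // /adj ab.
have := subsetP AE _ abA; rewrite mem_edges_in aU bU.
by case/and3P=> ->.
Qed.

Lemma component_split E A v U S : simple_edges E -> A \subset edges_in E S ->
  component A v = U -> A \subset edges_in E U :|: edges_in E (S :\: U).
Proof.
move=> sE AE compU; apply/subsetP => e eA.
have := subsetP AE e eA; rewrite inE => /andP[eE eS].
have /cards2P[x [y [xy eq_e]]] := forall_inP sE e eE; rewrite {}eq_e in eA eE eS *.
rewrite !inE eE /= !subUset !sub1set !inE.
have xyA : adj A x y by rewrite /adj xy.
have -> : (x \in U) = (y \in U).
  by rewrite -compU !inE; apply: (same_connect1r (connect_adj_sym A) xyA).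
by move: eS; rewrite subUset !sub1set => /andP[-> ->]; case: (y \in U).
Qed.

Lemma component_union E A A' v U S :
    A \subset edges_in E U -> spans A U -> A' \subset edges_in E (S :\: U) ->
    v \in U ->
  component (A :|: A') v = U.
Proof.
move=> AE AU AE' vU; apply/setP => x; rewrite inE; apply/idP/idP => [vx|xU].
  apply: (connect_adj_stable _ vx vU) => a b /andP[ab].
  rewrite inE => /orP[/(subsetP AE)|/(subsetP AE')]; rewrite mem_edges_in.
    by case/and3P.
  by rewrite !inE => /and3P[_ /andP[/negPf->]].
by apply: (connect_adj_mono (subsetUl _ _)); apply: (spansP _ vU AU).
Qed.

Lemma edges_in_disjoint E U S : simple_edges E ->
  [disjoint edges_in E U & edges_in E (S :\: U)].
Proof.
move=> sE; rewrite -setI_eq0; apply/eqP/setP => e; rewrite !inE.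
apply/negP => /andP[/andP[eE eU] /andP[_]]; rewrite subsetD => /andP[_].
have /eqP e2 := forall_inP sE e eE.
rewrite disjoint_sym disjoints_subset => UC.
have : e \subset U :&: ~: U.
  rewrite subsetI eU; apply/subsetP => x xe; rewrite inE; apply/negP => xU.
  by have := subsetP UC x xU; rewrite inE xe.
by rewrite setICr subset0 => /eqP e0; rewrite e0 cards0 in e2.
Qed.

Variables (R : comNzRingType) (E : {set {set 'I_n}}).
Hypothesis sE : simple_edges E.

(** This is Z(S) of the overview; [edge_weight (1 + r)] below is W(S), which by [sum_subsets] is the
    same sum without the connectivity condition. *)
Definition connected_sum (r : R) S :=
  \sum_(A : {set {set 'I_n}} | (A \subset edges_in E S) && spans A S) r ^+ #|A|.

Definition edge_weight (t : R) S := t ^+ #|edges_in E S|.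

Lemma sum_subsets (I : finType) (r : R) (F : {set I}) :
  \sum_(A : {set I} | A \subset F) r ^+ #|A| = (1 + r) ^+ #|F|.
Proof.
have [k] := ubnP #|F|; elim: k F => // k IH F lt.
have [->|[x xF]] := set_0Vmem F.
  rewrite (big_pred1 set0) ?cards0 // => A; exact: subset0.
have xF' : x \notin F :\ x by rewrite !inE eqxx.
rewrite -(setD1K xF) big_subset_setU1 //.
have lt' : (#|F :\ x| < k)%N by rewrite [#|F|](cardsD1 x) xF in lt.
rewrite IH // cardsU1 xF' add1n exprS mulrDl mul1r [RHS]addrC; congr (_ + _).
rewrite -IH // mulr_sumr; apply: eq_bigr => A AF.
by rewrite cardsU1 exprD; case: (boolP (x \in A)) => // /(subsetP AF); rewrite (negPf xF').
Qed.

(** Expand the left side over all edge sets [A] inside [v |: S] and group them by the component of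
    [v]. Such an [A] consists of a connected edge set on that component and an arbitrary edge set on
    the remaining vertices. *)
Lemma edge_weight_conv (r : R) v S : v \notin S ->
  edge_weight (1 + r) (v |: S) =
  conv (shift v (connected_sum r)) (edge_weight (1 + r)) S.
Proof.
move=> vS; rewrite /edge_weight -sum_subsets.
rewrite (partition_big (fun A => component A v :\ v) (fun X => X \subset S)) /=; last first.
  move=> A AE; apply/subsetP => x; rewrite !inE => /andP[xv vx].
  have : x \in v |: S.
    apply: (connect_adj_stable _ vx (setU11 v S)) => a b /andP[_ /(subsetP AE)].
    by rewrite mem_edges_in => /and3P[].
  by rewrite !inE (negPf xv).
apply: eq_bigr => X XS; rewrite -sum_subsets /shift /connected_sum big_distrlr /=.
rewrite pair_big /=.
have vX : v \notin X by apply: contra vS; apply: subsetP.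
have SX : S :\: X = (v |: S) :\: (v |: X).
  by apply/setP => x; rewrite !inE negb_or; case: eqP => [->|//]; rewrite (negPf vS) andbF.
have compE A : (component A v :\ v == X) = (component A v == v |: X).
  apply/eqP/eqP => [<-|->]; first by rewrite setD1K // inE connect0.
  exact: setU1K.
rewrite SX; set U := v |: X; have vU : v \in U by rewrite setU11.
(* Edge sets whose component at [v] is [U] correspond to pairs: the edges inside [U] and the edges
   avoiding [U]. *)
rewrite (reindex_onto (fun p : _ * _ => p.1 :|: p.2)
   (fun A => (A :&: edges_in E U, A :&: edges_in E ((v |: S) :\: U)))) /=; last first.
  move=> A; rewrite compE => /andP[AE /eqP compU]; rewrite -setIUr; apply/setIidPl.
  exact: component_split compU.
have US : U \subset v |: S by apply: setUS.
have dis := edges_in_disjoint U (v |: S) sE.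
have disI A A' : A \subset edges_in E U -> A' \subset edges_in E ((v |: S) :\: U) ->
    A :&: A' = set0.
  by move=> AE AE'; apply/eqP; rewrite setI_eq0; apply: disjointWl AE (disjointWr AE' dis).
apply: eq_big => [[A1 A2]|[A1 A2]] /=.
  rewrite compE; apply/idP/idP.
    move=> /andP[/andP[AE /eqP compU] /eqP[E1 E2]].
    have -> : A1 \subset edges_in E U by rewrite -E1 subsetIr.
    have -> : A2 \subset edges_in E ((v |: S) :\: U) by rewrite -E2 subsetIr.
    by rewrite andbT -E1; apply: spans_component AE compU vU.
  move=> /andP[/andP[AE AU] AE2]; rewrite (component_union AE AU AE2 vU) eqxx andbT.
  apply/andP; split.
    rewrite subUset; apply/andP; split; [apply: (subset_trans AE)|apply: (subset_trans AE2)];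
      apply/subsetP => e; rewrite !inE => /andP[-> H] /=; apply: (subset_trans H) => //.
    exact: subsetDl.
  rewrite !setIUl (setIidPl AE) (setIidPl AE2).
  by rewrite (setIC A2) (disI _ _ (subxx _) AE2) (disI _ _ AE (subxx _)) setU0 set0U.
rewrite compE => /andP[/andP[AE /eqP compU] /eqP[E1 E2]].
have AE1 : A1 \subset edges_in E U by rewrite -E1 subsetIr.
have AE2 : A2 \subset edges_in E ((v |: S) :\: U) by rewrite -E2 subsetIr.
by rewrite cardsU (disI _ _ AE1 AE2) cards0 subn0 exprD.
Qed.

Definition degree_in v S := #|[set x in S | [set v; x] \in E]|.

Lemma edge_weight_setU1 (t : R) v S : v \notin S ->
  edge_weight t (v |: S) = t ^+ degree_in v S * edge_weight t S.
Proof.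
move=> vS; rewrite /edge_weight -exprD; congr (_ ^+ _).
have -> : edges_in E (v |: S) =
    [set [set v; x] | x in [set x in S | [set v; x] \in E]] :|: edges_in E S.
  apply/setP => e; rewrite !inE; apply/idP/idP; last first.
    case/orP => [/imsetP[x]|/andP[-> eS]].
      by rewrite inE => /andP[xS xE] ->; rewrite xE subUset !sub1set !inE eqxx xS orbT.
    by apply: subset_trans eS _; apply: subsetUr.
  case/andP => eE eS; rewrite eE /=.
  have [ve|ve] := boolP (v \in e); last first.
    rewrite orbC; apply/orP; left; apply/subsetP => x xe; have := subsetP eS x xe.
    by rewrite !inE => /orP[/eqP xv|//]; rewrite -xv xe in ve.
  apply/orP; left; have /eqP := forall_inP sE e eE; rewrite (cardsD1 v) ve add1n => -[].
  move/eqP/cards1P => [x ex]; have xe : x \in e :\ v by rewrite ex inE.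
  move: xe (subsetP eS x); rewrite !inE => /andP[xv xe] /(_ xe); rewrite (negPf xv) /= => xS.
  have ee : e = [set v; x] by rewrite -(setD1K ve) ex.
  by apply/imsetP; exists x => //; rewrite inE xS -ee eE.
rewrite cardsU (_ : _ :&: _ = set0); last first.
  apply/setP => e; rewrite !inE; apply/negP => /andP[/imsetP[x _ ->]].
  by rewrite subUset !sub1set (negPf vS) andbF.
rewrite cards0 subn0 card_in_imset // => x y; rewrite !inE => /andP[xS _] /andP[yS _] exy.
have : x \in [set v; y] by rewrite -exy !inE eqxx orbT.
by rewrite !inE => /orP[/eqP xv|/eqP//]; rewrite -xv xS in vS.
Qed.

Lemma degree_inU v S P : [disjoint S & P] ->
  degree_in v (S :|: P) = (degree_in v S + degree_in v P)%N.
Proof.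
move=> d; rewrite /degree_in -cardsUI -[LHS]addn0; congr (_ + _)%N.
  by apply: eq_card => x; rewrite !inE andb_orl.
apply/esym/eqP; rewrite cards_eq0; apply/eqP/setP => x; rewrite !inE.
apply/negP => /andP[/andP[xS _] /andP[xP _]].
by have := disjointFr d xS; rewrite xP.
Qed.

Lemma edges_in0 : edges_in E set0 = set0.
Proof.
apply/setP => e; rewrite !inE subset0; apply/negP => /andP[eE /eqP e0].
by have := forall_inP sE e eE; rewrite e0 cards0.
Qed.

Lemma connected_sum_recursion (r : R) v w S :
    v != w -> v \notin S -> w \notin S ->
  connected_sum r (v |: (w |: S)) =
  \sum_(X : {set 'I_n} | X \subset S) connected_sum r (w |: X) *
    ((1 + r) ^+ degree_in v (w |: X) - 1) * connected_sum r (v |: (S :\: X)).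
Proof.
apply: (log_recursion (W := edge_weight (1 + r)) (m := fun X => (1 + r) ^+ degree_in v X)).
- by rewrite /edge_weight edges_in0 cards0.
- by move=> x X xX; apply: edge_weight_conv.
- by move=> X vX; apply: edge_weight_setU1.
- by move=> X Y d; rewrite degree_inU // exprD.
Qed.

Lemma connected_sum1 (r : R) v : connected_sum r [set v] = 1.
Proof.
have := edge_weight_conv r (v := v) (S := set0); rewrite inE => /(_ isT).
rewrite /conv (big_pred1 set0); last by move=> X; rewrite subset0.
rewrite edge_weight_setU1 ?inE // set0D /edge_weight edges_in0 cards0 expr0 !mulr1.
rewrite /shift setU0 => <-; rewrite /degree_in.
by rewrite (_ : [set x in _ | _] = set0) ?cards0 //; apply/setP => x; rewrite !inE.
Qed.

Definition separated P Q := forall x y, x \in P -> y \in Q -> [set x; y] \notin E.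

Lemma connected_sum_separated (r : R) P Q x y :
    x \in P -> y \in Q -> [disjoint P & Q] -> separated P Q ->
  connected_sum r (P :|: Q) = 0.
Proof.
move=> xP yQ d sep; apply: big_pred0 => A; apply/negP => /andP[AE /spansP].
have xU : x \in P :|: Q by rewrite inE xP.
have yU : y \in P :|: Q by rewrite inE yQ orbT.
move=> /(_ x xU) /(_ _ yU) xy; suff : y \in P by rewrite (disjointFl d yQ).
apply: (connect_adj_stable _ xy xP) => a b /andP[ab /(subsetP AE)].
rewrite mem_edges_in !inE => /and3P[abE _ /orP[//|bQ]] aP.
by have := sep a b aP bQ; rewrite abE.
Qed.

End Clusters.

(** * Location of the roots *)

Lemma Rel_connected_sum (R : fieldType) n (E : {set {set 'I_n}}) (q : R) :
    (0 < n)%N -> q != 0 ->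
  Rel E q = q ^+ #|E| * connected_sum E (q^-1 - 1) setT.
Proof.
move=> n0 q0; rewrite /Rel /connected_sum mulr_sumr.
have -> : edges_in E setT = E by apply/setP => e; rewrite !inE subsetT andbT.
apply: eq_big => [A|A].
  rewrite powersetE /connectedb n0 /=; congr (_ && _).
  by apply/forallP/forallP => H x; move: (H x); rewrite ?inE /= => /forallP H';
    apply/forallP => y; move: (H' y); rewrite ?inE.
move=> /andP[]; rewrite powersetE => AE _.
have -> : q^-1 - 1 = (1 - q) / q by rewrite mulrBl mul1r divff.
rewrite expr_div_n mulrCA; congr (_ * _).
rewrite -[in RHS](subnK (subset_leq_card AE)) exprD mulfK // expf_neq0 //.
Qed.

Section Signs.
Variables (R : realFieldType) (n : nat) (E : {set {set 'I_n}}).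
Hypothesis sE : simple_edges E.
Implicit Types (U S X : {set 'I_n}) (v w : 'I_n) (r q : R).

Lemma expr_lt1_norm (t : R) d : `|t| < 1 -> (0 < d)%N -> t ^+ d < 1.
Proof.
move=> t1 d0; apply: le_lt_trans (ler_norm _) _; rewrite normrX.
by rewrite exprn_ilt1 // -lt0n.
Qed.

Lemma expr_le1_norm (t : R) d : `|t| < 1 -> t ^+ d <= 1.
Proof. by case: d => [|d] t1; [rewrite expr0|apply/ltW/expr_lt1_norm]. Qed.

(** The sets [w |: X] and [v |: (S :\: X)] partition [v |: (w |: S)], so the signs multiply up to
    one factor -1, which reverses the middle difference. *)
Lemma connected_sum_sign_term r v w S X : v != w -> v \notin S -> w \notin S ->
    X \subset S ->
  (-1) ^+ #|v |: (w |: S)|.+1 * (connected_sum E r (w |: X) *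
    ((1 + r) ^+ degree_in E v (w |: X) - 1) * connected_sum E r (v |: (S :\: X))) =
  ((-1) ^+ #|w |: X|.+1 * connected_sum E r (w |: X)) *
  (1 - (1 + r) ^+ degree_in E v (w |: X)) *
  ((-1) ^+ #|v |: (S :\: X)|.+1 * connected_sum E r (v |: (S :\: X))).
Proof.
move=> vw vS wS XS.
have vwS : v \notin w |: S by rewrite !inE negb_or vw.
have wX : w \notin X by apply: contra wS; apply: subsetP.
have vX : v \notin S :\: X by rewrite inE (negPf vS) andbF.
rewrite !cardsU1 vwS wS wX vX !add1n -(cardsID X S) (setIidPr XS).
rewrite !exprS exprD.
move: (_ ^+ #|X|) (_ ^+ #|S :\: X|) (connected_sum _ _ _) (_ ^+ degree_in _ _ _)
  (connected_sum _ _ _) => a b x y z; ring.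
Qed.

(** Strong induction on the size of [S]: after distributing the sign, every term of the recursion is
    a product of three nonnegative factors. *)
Lemma connected_sum_sign r S : `|1 + r| < 1 -> S != set0 ->
  0 <= (-1) ^+ #|S|.+1 * connected_sum E r S.
Proof.
move=> r1; have [k] := ubnP #|S|; elim: k S => // k IH S lt /set0Pn[v vS].
have vv : v \notin S :\ v by rewrite !inE eqxx.
rewrite -(setD1K vS) in lt *; move: (S :\ v) vv lt => {vS}S vS lt.
have [->|[w wS]] := set_0Vmem S.
  by rewrite setU0 connected_sum1 // cards1 sqrrN expr1n mulr1.
have ww : w \notin S :\ w by rewrite !inE eqxx.
rewrite -(setD1K wS) in lt vS *; move: (S :\ w) ww lt vS => {wS}S wS lt.
rewrite !inE negb_or => /andP[vw vS].
rewrite cardsU1 !inE negb_or vw vS ltnS in lt.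
rewrite connected_sum_recursion // mulr_sumr; apply: sumr_ge0 => X XS.
rewrite connected_sum_sign_term //; apply: mulr_ge0; first apply: mulr_ge0.
- apply: IH; last by apply/set0Pn; exists w; rewrite setU11.
  by apply: leq_trans lt; rewrite ltnS subset_leq_card // setUS.
- by rewrite subr_ge0 expr_le1_norm.
- apply: IH; last by apply/set0Pn; exists v; rewrite setU11.
  apply: leq_trans lt; rewrite !cardsU1 wS !inE (negPf vS) andbF ltnS.
  by rewrite leq_add2l subset_leq_card // subsetDl.
Qed.

(** Apply the recursion at [v] and its neighbour [w]. The term that takes all of [U] is strictly
    positive because [v] has positive degree into [U]; the other terms are nonnegative. *)
Lemma connected_sum_sign_step r U v w : `|1 + r| < 1 ->
    w \in U -> v \notin U -> [set v; w] \in E ->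
    0 < (-1) ^+ #|U|.+1 * connected_sum E r U ->
  0 < (-1) ^+ #|v |: U|.+1 * connected_sum E r (v |: U).
Proof.
move=> r1 wU vU vwE U0.
have ww : w \notin U :\ w by rewrite !inE eqxx.
rewrite -(setD1K wU) in U0 vU *; move: (U :\ w) ww U0 vU => {wU}S wS U0.
rewrite !inE negb_or => /andP[vw vS].
rewrite connected_sum_recursion // mulr_sumr (bigD1 S) //=.
apply: ltr_pwDl.
  rewrite connected_sum_sign_term // setDv setU0 connected_sum1 //.
  rewrite cards1 sqrrN expr1n !mulr1; apply: mulr_gt0 => //; rewrite subr_gt0.
  rewrite expr_lt1_norm // card_gt0; apply/set0Pn; exists w.
  by rewrite !inE eqxx.
apply: sumr_ge0 => X /andP[XS _]; rewrite connected_sum_sign_term //.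
apply: mulr_ge0; first apply: mulr_ge0.
- by apply: connected_sum_sign => //; apply/set0Pn; exists w; rewrite setU11.
- by rewrite subr_ge0 expr_le1_norm.
- by apply: connected_sum_sign => //; apply/set0Pn; exists v; rewrite setU11.
Qed.

(** Take a largest set containing [v0] on which the sign is strict. An edge leaving it would give a
    larger one by [connected_sum_sign_step], so by connectedness it contains every vertex. *)
Lemma connected_sum_neq0 r : `|1 + r| < 1 -> connectedb E ->
  connected_sum E r setT != 0.
Proof.
move=> r1 /andP[n0 /forallP conn]; pose v0 := Ordinal n0.
pose P U := (v0 \in U) && (0 < (-1) ^+ #|U|.+1 * connected_sum E r U).
have P0 : P [set v0].
  by rewrite /P inE eqxx connected_sum1 // cards1 sqrrN expr1n mulr1 ltr01.
case: (arg_maxnP (fun U => #|U|) P0) => U /andP[v0U U0] Umax.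
have UT : U = setT.
  apply/setP => y; rewrite inE; have /forallP/(_ y) v0y := conn v0.
  apply: (connect_adj_stable _ v0y v0U) => a b /andP[ab abE] aU.
  apply: contraT => bU; have := Umax (b |: U).
  rewrite /P !inE v0U orbT /= (@connected_sum_sign_step _ _ _ a) //; last first.
    by rewrite setUC.
  by move=> /(_ isT); rewrite cardsU1 bU add1n ltnn.
by move: U0; rewrite UT; apply: contraTneq => ->; rewrite mulr0 ltxx.
Qed.

Lemma Rel_root_range q : connectedb E -> Rel E q = 0 -> -1 <= q <= 0 \/ q = 1.
Proof.
move=> conn; have n0 : (0 < n)%N by case/andP: conn.
have [->|qn0] := eqVneq q 0; first by rewrite lexx lerN10; left.
have [->|qn1] := eqVneq q 1; first by right.
move=> Rel0; left.
have z0 : connected_sum E (q^-1 - 1) setT = 0.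
  move/eqP: Rel0; rewrite Rel_connected_sum // mulf_eq0 expf_eq0 (negPf qn0) andbF.
  by move/eqP.
have qle1 : `|q| <= 1.
  rewrite leNgt; apply/negP => q1.
  have := @connected_sum_neq0 (q^-1 - 1) _ conn; rewrite z0 eqxx => H.
  suff : false by []; apply: H.
  by rewrite addrC subrK normfV invf_lt1 // (lt_trans ltr01).
have qle0 : q <= 0.
  rewrite leNgt; apply/negP => q0.
  have q1 : q < 1 by rewrite lt_neqAle qn1 (le_trans (ler_norm _) qle1).
  have : 0 < Rel E q.
    rewrite /Rel (bigD1 E) /=; last by rewrite powersetE subxx conn.
    apply: ltr_pwDl; first by rewrite subnn mulr1 exprn_gt0 // subr_gt0.
    apply: sumr_ge0 => A _; rewrite mulr_ge0 // exprn_ge0 // ?subr_ge0 ltW //.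
  by rewrite Rel0 ltxx.
by rewrite qle0 andbT; move: qle1; rewrite ler_norml => /andP[].
Qed.

End Signs.

(** * Gluing graphs along vertices *)

Section Gluing.
Variables (R : comNzRingType) (n : nat) (E : {set {set 'I_n}}) (r : R).
Hypothesis sE : simple_edges E.
Implicit Types (P Q S X Z : {set 'I_n}) (a c d v w : 'I_n).
Local Notation zeta := (connected_sum E r).
Local Notation t := (1 + r).

Lemma separated_sym P Q : separated E P Q -> separated E Q P.
Proof. by move=> sep x y xQ yP; rewrite setUC sep. Qed.

Lemma separatedW P P' Q Q' : P \subset P' -> Q \subset Q' ->
  separated E P' Q' -> separated E P Q.
Proof. by move=> PP QQ sep x y /(subsetP PP) xP /(subsetP QQ); apply: sep. Qed.

Lemma big_subset_support (I : finType) (F : {set I} -> R) (P S : {set I}) : P \subset S ->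
    (forall X : {set I}, X \subset S -> ~~ (X \subset P) -> F X = 0) ->
  \sum_(X : {set I} | X \subset S) F X = \sum_(X : {set I} | X \subset P) F X.
Proof.
move=> PS F0; rewrite (bigID (fun X : {set I} => X \subset P)) /= [X in _ + X]big1 ?addr0.
  by apply: eq_bigl => X; apply: andb_idl => XP; apply: subset_trans PS.
by move=> X /andP[]; apply: F0.
Qed.

(** Such an [X] has vertices on both sides and no edge between them. *)
Lemma connected_sum_straddle P Q x X : [disjoint P & Q] -> separated E P Q ->
  x \in P -> x \in X -> X \subset P :|: Q -> ~~ (X \subset P) -> zeta X = 0.
Proof.
move=> d sep xP xX XS XP.
have [y yX yP] := subsetPn XP.
have yQ : y \in Q by have := subsetP XS y yX; rewrite inE (negPf yP).
have -> : X = (X :&: P) :|: (X :&: Q) by rewrite -setIUr (setIidPl XS).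
apply: (@connected_sum_separated _ _ _ _ _ _ x y); rewrite ?inE ?xX ?yX //.
  exact: disjointWl (subsetIr _ _) (disjointWr (subsetIr _ _) d).
by apply: separatedW sep; apply: subsetIr.
Qed.

(** Induction on the size of [P], by the recursion at [c] and a vertex [w] of [P]. The part
    containing [w] avoids [c], so it contributes only when it stays inside [P]; the part containing
    [c] then factors by induction. *)
Lemma connected_sum_cut_vertex c P Q : c \notin P -> c \notin Q ->
    [disjoint P & Q] -> separated E P Q ->
  zeta (c |: (P :|: Q)) = zeta (c |: P) * zeta (c |: Q).
Proof.
have [k] := ubnP #|P|; elim: k P => // k IH P lt cP cQ d sep.
have [->|[w wP]] := set_0Vmem P.
  by rewrite set0U setU0 connected_sum1 // mul1r.
have ww : w \notin P :\ w by rewrite !inE eqxx.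
have wQ : w \notin Q by rewrite (disjointFr d).
rewrite -(setD1K wP) in lt cP d sep *; move: (P :\ w) ww lt cP d sep => {wP}P wP lt.
rewrite !inE negb_or => /andP[cw cP] d sep.
have d' : [disjoint P & Q] by apply: disjointWl d; apply: subsetUr.
have sep' : separated E P Q by apply: separatedW sep => //; apply: subsetUr.
rewrite -setUA connected_sum_recursion // ?inE ?negb_or ?cP ?wP //.
rewrite connected_sum_recursion // mulr_suml.
rewrite (big_subset_support (subsetUl P Q)); last first.
  move=> X XS XP; rewrite (@connected_sum_straddle (w |: P) Q w) ?mul0r //.
  - by rewrite setU11.
  - by rewrite setU11.
  - by rewrite -setUA setUS.
  rewrite subUset sub1set setU11 /=; apply: contra XP => XP; apply/subsetP => x xX.
  have := subsetP XP x xX; rewrite !inE => /orP[/eqP xw|//].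
  by have := subsetP XS x xX; rewrite xw !inE (negPf wP) (negPf wQ).
apply: eq_bigr => X XP; rewrite -[RHS]mulrA; congr (_ * _).
have -> : (P :|: Q) :\: X = (P :\: X) :|: Q.
  rewrite setDUl; congr (_ :|: _); apply/setDidPl; rewrite disjoint_sym.
  exact: disjointWl d'.
apply: IH => //.
- rewrite cardsU1 wP add1n ltnS in lt; apply: leq_ltn_trans lt.
  by rewrite subset_leq_card // subsetDl.
- by rewrite inE (negPf cP) andbF.
- by apply: disjointWl d'; apply: subsetDl.
- by apply: separatedW sep' => //; apply: subsetDl.
Qed.

(* The configurations in which [a] and [d] lie in two different clusters that
   together cover [P]. *)
Definition split_sum a d P := conv (shift a zeta) (shift d zeta) P.

(** This is the case where [c] lies in the cluster of [d]. The cluster of [a] then cannot reach [Q],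
    and [c] is a cut vertex of the other cluster. *)
Lemma split_sum_series_half a c d P Q :
    a != c -> c != d -> a != d -> c \notin P -> c \notin Q ->
    [disjoint a |: P & d |: Q] -> separated E (a |: P) (d |: Q) ->
  conv (shift a zeta) (shift c (shift d zeta)) (P :|: Q) =
  split_sum a c P * zeta (c |: (d |: Q)).
Proof.
move=> ac cd ad cP cQ dis sep.
have aQ : a \notin Q.
  by have := disjointFr dis (setU11 a P); rewrite !inE => /norP[].
have disPQ : [disjoint P & d |: Q] by apply: disjointWl dis; apply: subsetUr.
rewrite /conv (big_subset_support (subsetUl P Q)); last first.
  move=> X XS XP; rewrite /shift (@connected_sum_straddle (a |: P) (d |: Q) a) ?mul0r //.
  - by rewrite setU11.
  - by rewrite setU11.
  - by rewrite -setUA setUS // (subset_trans XS) // setUS // subsetUr.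
  have [y yX yP] := subsetPn XP.
  apply/subsetPn; exists y; first by rewrite inE yX orbT.
  rewrite !inE negb_or yP andbT; apply: contra aQ => /eqP ya.
  by have := subsetP XS y yX; rewrite !inE (negPf yP) ya.
rewrite mulr_suml; apply: eq_bigr => X XP; rewrite -mulrA; congr (_ * _).
have -> : (P :|: Q) :\: X = (P :\: X) :|: Q.
  rewrite setDUl; congr (_ :|: _); apply/setDidPl; rewrite disjoint_sym.
  by apply: disjointWl XP _; apply: disjointWr disPQ; apply: subsetUr.
rewrite /shift setUCA [d |: (_ :|: Q)]setUCA.
rewrite connected_sum_cut_vertex //.
- by rewrite inE (negPf cP) andbF.
- by rewrite !inE negb_or cd.
- by apply: disjointWl disPQ; apply: subsetDl.
- apply: separatedW sep => //; apply: subset_trans (subsetDl _ _) _; exact: subsetUr.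
Qed.

(** For two blocks in series at [c], the Leibniz rule separates the cases where [c] lies in the
    cluster of [a] or in that of [d]; they are symmetric. *)
Lemma split_sum_series a c d P Q :
    a != c -> c != d -> a != d -> c \notin P -> c \notin Q ->
    [disjoint a |: P & d |: Q] -> separated E (a |: P) (d |: Q) ->
  split_sum a d (c |: (P :|: Q)) =
  zeta (a |: (c |: P)) * split_sum c d Q + split_sum a c P * zeta (c |: (d |: Q)).
Proof.
move=> ac cd ad cP cQ dis sep.
rewrite /split_sum conv_setU1 ?inE ?negb_or ?cP // [X in _ + X]split_sum_series_half //.
congr (_ + _); rewrite convC setUC split_sum_series_half //.
- by rewrite /split_sum convC mulrC [a |: (c |: P)]setUCA.
- by rewrite eq_sym.
- by rewrite eq_sym.
- by rewrite eq_sym.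
- by rewrite disjoint_sym.
- exact: separated_sym.
Qed.

(** Use the recursion at [v] and [a], according to whether the part of [a] contains [d]. If it does,
    it must be everything, since [v] has no other neighbours, and [v] has degree 2 into it. If not,
    [v] hangs from [d] by a single edge of weight [t - 1], and the degree into the part of [a] is
    1. *)
Lemma connected_sum_ear v a d P : a != d -> a \notin P -> d \notin P ->
    v \notin a |: (d |: P) -> [set v; a] \in E -> [set v; d] \in E ->
    (forall x, x \in P -> [set v; x] \notin E) ->
  zeta (v |: (a |: (d |: P))) =
  (t ^+ 2 - 1) * zeta (a |: (d |: P)) + (t - 1) ^+ 2 * split_sum a d P.
Proof.
move=> ad aP dP; rewrite !inE !negb_or => /and3P[va vd vP] vaE vdE vPE.
have deg0 X : X \subset P -> degree_in E v X = 0%N.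
  move=> XP; apply/eqP; rewrite cards_eq0; apply/eqP/setP => x; rewrite !inE.
  by apply/negP => /andP[/(subsetP XP)/vPE/negPf->].
have deg1 x : [set v; x] \in E -> degree_in E v [set x] = 1%N.
  move=> vxE; rewrite /degree_in (_ : [set _ in _ | _] = [set x]) ?cards1 //.
  by apply/setP => y; rewrite !inE; apply: andb_idr => /eqP->.
have degU x X : x \notin X -> [set v; x] \in E ->
    degree_in E v (x |: X) = (degree_in E v X).+1.
  by move=> xX vxE; rewrite degree_inU ?deg1 // disjoints1.
have edge : zeta (v |: [set d]) = t - 1.
  have := connected_sum_recursion sE r (S := set0) vd; rewrite !in_set0 => /(_ isT isT).
  rewrite (big_pred1 set0); last by move=> X; rewrite subset0.
  by rewrite !setU0 set0D setU0 !connected_sum1 // deg1 // mul1r mulr1.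
have aS : a \notin d |: P by rewrite !inE negb_or ad.
have vS : v \notin d |: P by rewrite !inE negb_or vd.
rewrite connected_sum_recursion // big_subset_setU1 //; congr (_ + _).
  rewrite (bigD1 P) //= big1 ?addr0; last first.
    move=> X /andP[XP neq]; have /subsetPn[x xP xX] : ~~ (P \subset X).
      by apply: contra neq => PX; rewrite eqEsubset XP.
    rewrite (@connected_sum_separated _ _ _ _ [set v] _ v x) ?mulr0 ?inE ?negb_or //.
    - by rewrite xP xX orbT !andbT; apply: contraNneq dP => <-.
    - by rewrite disjoints1 !inE (negPf vd) (negPf vP) andbF.
    move=> _ y /set1P-> ; rewrite !inE negb_or => /andP[/andP[yd _]].
    by rewrite (negPf yd) => /vPE.
  rewrite setDv setU0 connected_sum1 // mulr1 mulrC.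
  by rewrite degU // degU // deg0.
rewrite /split_sum /conv mulr_sumr; apply: eq_bigr => X XP.
have aX : a \notin X by apply: contra aP; apply: subsetP.
rewrite degU // deg0 // expr1.
have -> : (d |: P) :\: X = d |: (P :\: X).
  apply/setP => y; rewrite !inE; case: eqP => [->|//]; rewrite andbT.
  by apply: contra dP; apply: subsetP.
rewrite setUCA connected_sum_cut_vertex //.
- by rewrite [d |: [set v]]setUC edge /shift expr2; ring.
- by rewrite inE eq_sym.
- by rewrite inE (negPf dP) andbF.
- by rewrite disjoints1 inE (negPf vP) andbF.
by move=> _ y /set1P-> ; rewrite inE => /andP[_ /vPE].
Qed.

End Gluing.

(** * Reliability of complete graphs *)

Lemma sum_subsets_card (R : pzSemiRingType) (T : finType) (S : {set T}) (F : nat -> R) :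
  \sum_(X : {set T} | X \subset S) F #|X| =
  \sum_(i < #|S|.+1) 'C(#|S|, i)%:R * F i.
Proof.
rewrite (partition_big (fun X : {set T} => inord #|X| : 'I_#|S|.+1) xpredT) //=.
apply: eq_bigr => i _; rewrite -cards_draws mulr_natl -sumr_const.
apply: eq_big => X; rewrite ?inE.
  apply: andb_id2l => XS; rewrite -val_eqE /= inordK ?ltnS ?subset_leq_card //.
by move=> /andP[XS /eqP <-]; rewrite inordK ?ltnS ?subset_leq_card.
Qed.

Lemma bin2D i j : 'C(i + j, 2) = ('C(i, 2) + 'C(j, 2) + i * j)%N.
Proof. by elim: i => [|i IH]; rewrite ?addn0 // addSn !binS !bin1 IH; lia. Qed.

Section CliqueReliability.
Variables (R : comNzRingType) (q : R).

(** The list of the first [m] values is built because the recursion refers to all smaller sizes. *)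
Fixpoint clique_rels m : seq R :=
  if m is m'.+1 then
    rcons (clique_rels m')
      (1 - \sum_(i < m') 'C(m', i)%:R * (clique_rels m')`_i * q ^+ (i.+1 * (m' - i)))
  else [::].

(* The reliability of the complete graph with [m.+1] vertices. *)
Definition clique_rel m := (clique_rels m.+1)`_m.

Lemma size_clique_rels m : size (clique_rels m) = m.
Proof. by elim: m => //= m IH; rewrite size_rcons IH. Qed.

Lemma nth_clique_rels m i : (i < m)%N -> (clique_rels m)`_i = clique_rel i.
Proof.
elim: m => // m IH; rewrite ltnS leq_eqVlt => /orP[/eqP->//|im].
by rewrite /= nth_rcons size_clique_rels im IH.
Qed.

(** Here [i.+1] is the size of the component of a fixed vertex, and the power of [q] accounts for
    the failure of all edges leaving it. *)
Lemma clique_relE m :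
  clique_rel m =
  1 - \sum_(i < m) 'C(m, i)%:R * clique_rel i * q ^+ (i.+1 * (m - i)).
Proof.
rewrite {1}/clique_rel /= nth_rcons size_clique_rels ltnn eqxx; congr (_ - _).
by apply: eq_bigr => i _; rewrite nth_clique_rels.
Qed.

(* The split sum, in normalized form, of two vertices of the complete graph
   with [p.+2] vertices. *)
Definition clique_split p :=
  \sum_(i < p.+1) 'C(p, i)%:R *
    (clique_rel i * clique_rel (p - i) * q ^+ (i.+1 * (p - i).+1)).

End CliqueReliability.

Lemma exprVD (R : fieldType) (q : R) a b c : q != 0 ->
  q ^- a * q ^- b = q ^+ c * q ^- (a + b + c).
Proof. by move=> q0; rewrite !exprD !invfM [RHS]mulrC mulfVK // expf_neq0. Qed.

Section Cliques.
Variables (R : fieldType) (n : nat) (E : {set {set 'I_n}}) (q : R).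
Hypotheses (sE : simple_edges E) (q0 : q != 0).
Implicit Types (S P X : {set 'I_n}).
Local Notation zeta := (connected_sum E (q^-1 - 1)).

Definition clique S := forall x y, x \in S -> y \in S -> x != y -> [set x; y] \in E.

Lemma cliqueW S P : S \subset P -> clique P -> clique S.
Proof. by move=> /subsetP SP cP x y /SP xP /SP; apply: cP. Qed.

Lemma card_edges_in_clique S : clique S -> #|edges_in E S| = 'C(#|S|, 2).
Proof.
move=> cS; rewrite -cards_draws; apply: eq_card => e; rewrite !inE.
apply/andP/andP => [[eE eS]|[eS e2]]; first by split=> //; apply: (forall_inP sE).
split=> //; have /cards2P[x [y [xy ee]]] := e2; move: eS; rewrite ee.
by rewrite subUset !sub1set => /andP[xS yS]; apply: cS.
Qed.

(** Solve [edge_weight_conv] for its term [X = S] and compare with [clique_relE]. The exponents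
    agree because the pairs of vertices split into those inside each part and those across. *)
Lemma connected_sum_clique v S : v \notin S -> clique (v |: S) ->
  zeta (v |: S) = clique_rel q #|S| * q ^- 'C(#|S|.+1, 2).
Proof.
have [k] := ubnP #|S|; elim: k S => // k IH S lt vS cS.
have := edge_weight_conv sE (q^-1 - 1) vS.
rewrite addrC subrK /edge_weight card_edges_in_clique // cardsU1 vS add1n.
rewrite /conv (bigD1 S) //= setDv card_edges_in_clique; last first.
  by move=> x y; rewrite inE.
rewrite cards0 /= expr0 mulr1 /shift => /eqP; rewrite -subr_eq => /eqP <-.
rewrite clique_relE mulrBl mul1r exprVn; congr (_ - _).
rewrite (eq_bigl (fun X => (X \subset S) && (X != S))) //.
rewrite mulr_suml.
(* The value 0 at [#|S|] lets the sum over proper subsets run over all subsets. *)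
pose F i := if (i < #|S|)%N then clique_rel q i * q ^- 'C(i.+1, 2) * q ^- 'C(#|S| - i, 2) else 0.
transitivity (\sum_(X : {set 'I_n} | X \subset S) F #|X|).
  rewrite [RHS](bigD1 S) //= [F #|S|]/F ltnn add0r; apply: eq_bigr => X /andP[XS XnS].
  have ltX : (#|X| < #|S|)%N by rewrite proper_card // properEneq XnS.
  rewrite /F ltX IH //; first last.
  - by apply: cliqueW cS; apply: setUS.
  - by apply: contra vS; apply: subsetP.
  - by rewrite -ltnS; apply: leq_trans lt.
  rewrite card_edges_in_clique; last first.
    by apply: cliqueW cS; apply: subset_trans (subsetDl _ _) (subsetUr _ _).
  by rewrite cardsD (setIidPr XS) exprVn.
rewrite sum_subsets_card big_ord_recr /= [F #|S|]/F ltnn mulr0 addr0.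
apply: eq_bigr => i _; rewrite /F ltn_ord.
have -> : 'C(#|S|.+1, 2) = ('C(i.+1, 2) + 'C(#|S| - i, 2) + i.+1 * (#|S| - i))%N.
  by rewrite -bin2D addSn subnKC // ltnW.
rewrite -!mulrA; congr (_ * (_ * _)).
exact: exprVD.
Qed.

Lemma split_sum_clique a d P : a \notin P -> d \notin P -> clique (a |: (d |: P)) ->
  split_sum E (q^-1 - 1) a d P = clique_split q #|P| * q ^- 'C(#|P|.+2, 2).
Proof.
move=> aP dP cP; pose p := #|P|.
pose F i := clique_rel q i * q ^- 'C(i.+1, 2) * (clique_rel q (p - i) * q ^- 'C((p - i).+1, 2)).
transitivity (\sum_(X : {set 'I_n} | X \subset P) F #|X|).
  apply: eq_bigr => X XP; rewrite /shift !connected_sum_clique.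
  - by rewrite cardsD (setIidPr XP).
  - by rewrite inE (negPf dP) andbF.
  - apply: cliqueW cP; apply: subset_trans (subsetUr _ _).
    by apply: setUS; apply: subsetDl.
  - by apply: contra aP; apply: subsetP.
  - by apply: cliqueW cP; apply: setUS; apply: subset_trans XP (subsetUr _ _).
rewrite sum_subsets_card mulr_suml; apply: eq_bigr => i _; rewrite /F -!mulrA.
congr (_ * (_ * _)); rewrite -/p.
have ip : (i <= p)%N by rewrite -ltnS.
have -> : 'C(p.+2, 2) = ('C(i.+1, 2) + 'C((p - i).+1, 2) + i.+1 * (p - i).+1)%N.
  by rewrite -bin2D addSn addnS subnKC.
rewrite mulrCA; congr (_ * _).
exact: exprVD.
Qed.

End Cliques.

(** * Asymptotics of clique reliabilities and split sums *)

Section Asymptotics.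
Variable R : archiRealFieldType.
Implicit Types s q : R.

Lemma sqr_geometric_small s (eps : R) : 0 <= s < 1 -> 0 < eps ->
  exists N0, forall N, (N0 <= N)%N -> N%:R ^+ 2 * s ^+ N./2 <= eps.
Proof.
move=> /andP[s0 s1] eps0; have [->|sn0] := eqVneq s 0.
  exists 2%N => N N2; rewrite expr0n (_ : (N./2 == 0)%N = false) ?mulr0 ?ltW //; lia.
have sgt0 : 0 < s by rewrite lt_def sn0.
pose h := s^-1 - 1; have h0 : 0 < h by rewrite subr_gt0 invf_gt1.
(* Bernoulli's inequality for [s^-1 = 1 + h] *)
have bern m : s ^+ m * (m%:R * h) <= 1.
  have : 1 + m%:R * h <= (1 + h) ^+ m.
    elim: m => [|m IH]; first by rewrite mul0r addr0.
    rewrite exprS; apply: le_trans (ler_wpM2l _ IH); last by lra.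
    have : 0 <= m%:R * h ^+ 2 by rewrite mulr_ge0 // sqr_ge0.
    by rewrite -natr1; nra.
  rewrite {2}/h addrC [1 + _]addrC subrK => H.
  have : s ^+ m * (m%:R * h) <= s ^+ m * s^-1 ^+ m.
    by rewrite ler_wpM2l ?exprn_ge0 //; lra.
  by rewrite -exprMn mulfV // expr1n.
(* With [m] about N/6, three Bernoulli factors bound [s ^+ N./2] by a multiple of [m ^ -3], which
   beats the square of [N]. The number 121 is the square of 11 in the bound [N <= 11 * m]. *)
pose K := 121 / (h ^+ 3 * eps).
have K0 : 0 <= K by rewrite divr_ge0 // mulr_ge0 ?exprn_ge0 // ltW.
pose m0 := (Num.truncn K).+1; exists (6 * m0 + 6)%N => N NN.
pose m := (N./2 %/ 3)%N.
have mm0 : (m0 <= m)%N by rewrite /m; lia.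
have N11 : (N <= 11 * m)%N by rewrite /m; lia.
have m3 : (3 * m <= N./2)%N by rewrite /m; lia.
have Km : K < m%:R by apply: lt_le_trans (truncnS_gt K) _; rewrite ler_nat.
have mgt0 : 0 < m%:R :> R by apply: le_lt_trans Km.
have sm : s ^+ N./2 <= s ^+ m ^+ 3.
  by rewrite -exprM mulnC ler_wiXn2l // ltW.
have le1 : N%:R ^+ 2 * s ^+ N./2 <= (11 * m%:R) ^+ 2 * (s ^+ m) ^+ 3.
  apply: ler_pM => //; rewrite ?exprn_ge0 //.
  by rewrite lerXn2r ?nnegrE ?mulr_ge0 // -natrM ler_nat.
apply: le_trans le1 _.
have : (s ^+ m * (m%:R * h)) ^+ 3 <= 1.
  by rewrite exprn_ile1 ?bern // !mulr_ge0 ?exprn_ge0 // ltW.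
move: Km; rewrite /K ltr_pdivrMr; last by rewrite mulr_gt0 ?exprn_gt0.
set x := s ^+ m; rewrite !exprMn => H1 H2.
rewrite -(ler_pM2r (_ : 0 < m%:R * h ^+ 3)); last by rewrite mulr_gt0 ?exprn_gt0.
have -> : 11 ^+ 2 * m%:R ^+ 2 * x ^+ 3 * (m%:R * h ^+ 3) = 121 * (x ^+ 3 * (m%:R ^+ 3 * h ^+ 3)).
  by ring.
lra.
Qed.

Definition middle_sum s N := \sum_(1 <= i < N) 'C(N, i)%:R * s ^+ (i * (N - i)).

Lemma bin_le_exp N k : ('C(N, k) <= N ^ k)%N.
Proof.
apply: leq_trans (leq_pmulr _ (fact_gt0 k)) _; rewrite bin_ffact.
elim: k => // k IH; by rewrite ffactnSr expnSr leq_mul ?IH ?leq_subr.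
Qed.

(** The binomial is at most [N ^ k], and [N - k] is at least [N./2], so the term is at most the
    [k]-th power of a base that is at most 1. *)
Lemma middle_term_le s N k : 0 <= s <= 1 -> (0 < k)%N -> (k <= N - k)%N ->
    N%:R * s ^+ N./2 <= 1 ->
  'C(N, k)%:R * s ^+ (k * (N - k)) <= N%:R * s ^+ N./2.
Proof.
move=> /andP[s0 s1] k0 kN x1; set x := N%:R * _.
have x0 : 0 <= x by rewrite mulr_ge0 ?exprn_ge0.
apply: (@le_trans _ _ (x ^+ k)).
  rewrite exprMn -exprM -natrX; apply: ler_pM => //; rewrite ?exprn_ge0 //.
    by rewrite ler_nat bin_le_exp.
  rewrite ler_wiXn2l // mulnC leq_mul2l; apply/orP; right; lia.
by case: k k0 {kN} => // k _; rewrite exprS ler_piMr // exprn_ile1.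
Qed.

(** By the symmetry of [i] and [N - i] each term is at most [x], and [N%:R * x] is the quantity
    bounded in [sqr_geometric_small]. *)
Lemma middle_sum_small s (eps : R) : 0 <= s < 1 -> 0 < eps ->
  exists N0, forall N, (N0 <= N)%N -> middle_sum s N <= eps.
Proof.
move=> s01 eps0; have s01' : 0 <= s <= 1 by case/andP: s01 => -> /ltW.
(* The bound by 1 provides the hypothesis of [middle_term_le]. *)
have [|N0 HN] := @sqr_geometric_small s (Num.min eps 1) s01; first by rewrite lt_min eps0 ltr01.
exists N0.+1 => N NN; have := HN N (ltnW NN); rewrite le_min => /andP[Heps H1].
set x := N%:R * s ^+ N./2.
have x0 : 0 <= x by rewrite mulr_ge0 ?exprn_ge0 //; case/andP: s01.
have Nx : N%:R ^+ 2 * s ^+ N./2 = N%:R * x by rewrite /x expr2 mulrA.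
have N1 : 1 <= N%:R :> R by rewrite ler1n; case: N NN {HN Heps H1 x x0 Nx}.
have x1 : x <= 1 by apply: le_trans H1; rewrite Nx ler_peMl.
rewrite Nx in Heps; apply: le_trans Heps.
apply: (@le_trans _ _ (\sum_(1 <= i < N) x)).
  apply: ler_sum_nat => i /andP[i0 iN].
  have [kN|kN] := leqP i (N - i); first exact: middle_term_le.
  rewrite -bin_sub ?(ltnW iN) // mulnC -{3}(subKn (ltnW iN)).
  by apply: middle_term_le => //; lia.
rewrite sumr_const_nat -[leLHS]mulr_natl ler_wpM2r // ler_nat; lia.
Qed.

Lemma geometric_small s (eps : R) : 0 <= s < 1 -> 0 < eps ->
  exists N0, forall N, (N0 <= N)%N -> s ^+ N <= eps.
Proof.
move=> s01 eps0; have [N0 HN] := sqr_geometric_small s01 eps0.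
exists N0.+1 => N NN; apply: le_trans (HN N (ltnW NN)).
have /andP[s0 s1] := s01.
apply: (@le_trans _ _ (s ^+ N./2)).
  by rewrite ler_wiXn2l ?(ltW s1) //; lia.
rewrite ler_peMl ?exprn_ge0 // -natrX ler1n expn_gt0; lia.
Qed.

Lemma clique_tail_le s m : 0 <= s <= 1 ->
  \sum_(i < m) 'C(m, i)%:R * s ^+ (i.+1 * (m - i)) <= s ^+ m + middle_sum s m.
Proof.
move=> /andP[s0 s1]; rewrite -(big_mkord xpredT (fun i => 'C(m, i)%:R * s ^+ (i.+1 * (m - i)))).
have [->|m0] := posnP m; first by rewrite /middle_sum !big_geq // addr0 expr0 ler01.
rewrite big_ltn // bin0 mul1r mul1n subn0 lerD2l; apply: ler_sum_nat => i _.
by rewrite ler_wpM2l // ler_wiXn2l // leq_mul2r leqnSn orbT.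
Qed.

Lemma clique_tail_small s (eps : R) : 0 <= s < 1 -> 0 < eps ->
  exists N0, forall N, (N0 <= N)%N ->
    \sum_(i < N) 'C(N, i)%:R * s ^+ (i.+1 * (N - i)) <= eps.
Proof.
move=> s01 eps0; have s01' : 0 <= s <= 1 by case/andP: s01 => -> /ltW.
have eps2 : 0 < eps / 2 by lra.
have [N1 H1] := geometric_small s01 eps2; have [N2 H2] := middle_sum_small s01 eps2.
exists (maxn N1 N2) => N; rewrite geq_max => /andP[NN1 NN2].
apply: le_trans (clique_tail_le _ s01') _.
by have := H1 N NN1; have := H2 N NN2; lra.
Qed.

Lemma clique_rel_sub1_le q (M : R) m : (forall i, (i < m)%N -> `|clique_rel q i| <= M) ->
  `|clique_rel q m - 1| <= M * \sum_(i < m) 'C(m, i)%:R * `|q| ^+ (i.+1 * (m - i)).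
Proof.
move=> HM; rewrite clique_relE addrAC subrr add0r normrN mulr_sumr.
apply: le_trans (ler_norm_sum _ _ _) _; apply: ler_sum => i _.
rewrite !normrM normrX normr_nat [_ * `|clique_rel _ _|]mulrC -mulrA.
by rewrite ler_wpM2r ?HM // mulr_ge0 // exprn_ge0.
Qed.

Lemma clique_rel_bounded q : `|q| < 1 ->
  exists2 M, 0 <= M & forall m, `|clique_rel q m| <= M.
Proof.
move=> q1; have [||N0 HN] := @clique_tail_small `|q| 2^-1; rewrite ?normr_ge0 ?invr_gt0 //.
pose B := \sum_(i < N0) `|clique_rel q i|.
have B0 : 0 <= B by apply: sumr_ge0.
(* [B] covers the indices below [N0]. Beyond, the tail is at most 1/2, and M = [B + 2] satisfies 1 +
   M/2 <= M, which closes the induction. *)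
exists (B + 2); first by lra.
move=> m; have [k] := ubnP m; elim: k m => // k IH m; rewrite ltnS => mk.
have [mN|Nm] := ltnP m N0.
  apply: (@le_trans _ _ B); last by lra.
  rewrite /B (bigD1 (Ordinal mN)) //= lerDl; exact: sumr_ge0.
have H : `|clique_rel q m - 1| <= (B + 2) * 2^-1.
  apply: le_trans (clique_rel_sub1_le (M := B + 2) _) _.
    by move=> i im; apply: IH; apply: leq_trans mk.
  by rewrite ler_wpM2l ?HN //; lra.
have := ler_normD (clique_rel q m - 1) 1; rewrite subrK normr1; lra.
Qed.

Lemma clique_rel_cvg1 q (eps : R) : `|q| < 1 -> 0 < eps ->
  exists N0, forall m, (N0 <= m)%N -> `|clique_rel q m - 1| <= eps.
Proof.
move=> q1 eps0; have [M M0 HM] := clique_rel_bounded q1.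
have [||N0 HN] := @clique_tail_small `|q| (eps / (M + 1)).
- by rewrite normr_ge0.
- by rewrite divr_gt0 //; lra.
exists N0 => m Nm; apply: le_trans (clique_rel_sub1_le (M := M) _) _ => //.
apply: (@le_trans _ _ (M * (eps / (M + 1)))); first by rewrite ler_wpM2l ?HN.
rewrite mulrA ler_pdivrMr; last by lra.
by rewrite mulrDr mulr1 mulrC lerDl ltW.
Qed.

(** The terms [i = 0] and [i = p], distinct as [p > 0], isolate one terminal and give the main term.
    In the others the exponent exceeds [p.+1] by [i * (p - i)]. *)
Lemma clique_split_le q (M : R) p : 0 <= M -> (forall i, `|clique_rel q i| <= M) ->
    (0 < p)%N ->
  `|clique_split q p - 2 * clique_rel q p * q ^+ p.+1| <=
  M ^+ 2 * `|q| ^+ p.+1 * middle_sum `|q| p.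
Proof.
move=> M0 HM p0; rewrite /clique_split.
pose F i := 'C(p, i)%:R * (clique_rel q i * clique_rel q (p - i) * q ^+ (i.+1 * (p - i).+1)).
rewrite -(big_mkord xpredT F) big_nat_recr //= big_ltn // /F bin0 binn !mul1r !subnn subn0.
have -> : clique_rel q 0 = 1 by rewrite clique_relE big_ord0 subr0.
rewrite mul1n muln1 mul1r mulr1.
set A := clique_rel q p * _; set S := \sum_(1 <= i < p) _.
have -> : A + S + A - 2 * clique_rel q p * q ^+ p.+1 = S by rewrite /A; ring.
rewrite /middle_sum mulr_sumr; apply: le_trans (ler_norm_sum _ _ _) _.
apply: ler_sum_nat => i /andP[i0 ip].
have -> : (i.+1 * (p - i).+1 = p.+1 + i * (p - i))%N by rewrite mulSn mulnS; lia.
rewrite !normrM !normrX normr_nat exprD.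
set x := `|q| ^+ p.+1; set y := `|q| ^+ _; set b := 'C(p, i)%:R.
rewrite (_ : M ^+ 2 * x * (b * y) = b * (M * M * (x * y))); last by ring.
rewrite ler_wpM2l // ler_wpM2r ?mulr_ge0 ?exprn_ge0 //.
by apply: ler_pM => //; apply: HM.
Qed.

Lemma clique_asymptotics q : 0 < `|q| < 1 ->
  exists p0, forall p, (p0 <= p)%N ->
    2^-1 <= clique_rel q p.+1 <= 2 /\
    exists2 rho, 1 <= rho <= 3 & clique_split q p = rho * q ^+ p.+1.
Proof.
move=> /andP[q0 q1]; have [M M0 HM] := clique_rel_bounded q1.
have [|N1 H1] := @clique_rel_cvg1 q 4^-1 q1; first by lra.
have [||N2 H2] := @middle_sum_small `|q| (2^-1 / (M ^+ 2 + 1)).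
- by rewrite normr_ge0.
- by rewrite divr_gt0 ?ltr_wpDl ?sqr_ge0 //; lra.
exists (maxn N1 N2).+1 => p; rewrite gtn_max => /andP[pN1 pN2].
have C1 := H1 p (ltnW pN1); have C2 := H1 p.+1 (ltnW (leqW pN1)).
split; first by move: C2; rewrite ler_norml => /andP[]; lra.
have p0 : (0 < p)%N by apply: leq_ltn_trans pN1.
have qn0 : q ^+ p.+1 != 0 by rewrite expf_neq0 // -normr_gt0.
exists (clique_split q p / q ^+ p.+1); last by rewrite divfK.
(* Since [clique_rel q p] is within 1/4 of 1, the quotient is then within 1/2 + 1/2 of 2. *)
suff : `|clique_split q p / q ^+ p.+1 - 2 * clique_rel q p| <= 2^-1.
  by move: C1; rewrite !ler_norml => /andP[? ?] /andP[? ?]; lra.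
rewrite -(ler_pM2r (_ : 0 < `|q| ^+ p.+1)) ?exprn_gt0 //.
rewrite -normrX -normrM mulrBl divfK // normrX.
apply: le_trans (clique_split_le M0 HM p0) _.
rewrite mulrAC ler_pM2r ?exprn_gt0 //.
have M2 : 0 < M ^+ 2 + 1 by rewrite ltr_wpDl ?sqr_ge0.
have := H2 p (ltnW pN2); rewrite ler_pdivlMr // => H.
have : 0 <= middle_sum `|q| p.
  by apply: sumr_ge0 => i _; rewrite mulr_ge0 // exprn_ge0.
by move: H; rewrite mulrDr mulr1 mulrC; lra.
Qed.

End Asymptotics.

(** * Rings of cliques *)

Lemma card_ord_interval N l u : (u <= N)%N -> #|[set x : 'I_N | l <= x < u]%N| = (u - l)%N.
Proof.
elim: u => [|u IH] uN.
  by apply/eqP; rewrite cards_eq0; apply/eqP/setP => x; rewrite !inE ltn0 andbF.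
have [lu|ul] := leqP l u; last first.
  rewrite (_ : _ - _ = 0)%N; last by lia.
  by apply/eqP; rewrite cards_eq0; apply/eqP/setP => x; rewrite !inE; lia.
rewrite subSn // -IH ?(ltnW uN) //.
have -> : [set x : 'I_N | l <= x < u.+1]%N = Ordinal uN |: [set x : 'I_N | l <= x < u]%N.
  by apply/setP => x; rewrite !inE -val_eqE /=; lia.
by rewrite cardsU1 inE /= ltnn andbF add1n.
Qed.

Section CliqueRing.
Variables (m k : nat).
Hypotheses (m0 : (0 < m)%N) (k0 : (0 < k)%N).

(* The vertices [i * k], ..., [i.+1 * k] form the [i]-th clique, for [i < m];
   the last vertex [m * k + 1] is joined to both ends [0] and [m * k]. *)
Local Notation N := (m * k).+2.

Definition clique_ring_rel (x y : nat) : bool :=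
  [|| [exists i : 'I_m, [&& i * k <= x <= i.+1 * k & i * k <= y <= i.+1 * k]],
      (x == (m * k).+1) && ((y == 0) || (y == m * k)) |
      (y == (m * k).+1) && ((x == 0) || (x == m * k))]%N.

Definition clique_ring : {set {set 'I_N}} :=
  [set e : {set 'I_N} | (#|e| == 2) &&
    [forall x in e, forall y in e, (x != y) ==> clique_ring_rel x y]].

Lemma clique_ring_simple : simple_edges clique_ring.
Proof. by apply/forall_inP => e; rewrite inE => /andP[]. Qed.

Lemma clique_ring_rel_sym x y : clique_ring_rel x y = clique_ring_rel y x.
Proof.
congr (_ || _).
  by apply: eq_existsb => i; rewrite andbC.
by rewrite orbC.
Qed.

Lemma mem_clique_ring (x y : 'I_N) : x != y ->
  ([set x; y] \in clique_ring) = clique_ring_rel x y.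
Proof.
move=> xy; rewrite inE cards2 xy eqxx /=; apply/forall_inP/idP.
  move=> /(_ x); rewrite !inE eqxx => /(_ isT) /forall_inP /(_ y).
  by rewrite !inE eqxx orbT xy => /(_ isT).
move=> xyr a; rewrite !inE => ax; apply/forall_inP => b; rewrite !inE => bx.
case/orP: ax => /eqP ->; case/orP: bx => /eqP ->; rewrite ?eqxx ?xyr ?implybT //.
by rewrite clique_ring_rel_sym xyr implybT.
Qed.

Definition joint i : 'I_N := inord (i * k).
Definition inside i j : {set 'I_N} := [set x : 'I_N | i * k < x < j * k]%N.
Definition apex : 'I_N := ord_max.

Lemma val_joint i : (i <= m)%N -> val (joint i) = (i * k)%N.
Proof. by move=> im; rewrite /joint /= inordK // ltnS leqW // leq_mul2r im orbT. Qed.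

Lemma joint_neq i j : (i < j)%N -> (j <= m)%N -> joint i != joint j.
Proof.
move=> ij jm; rewrite -val_eqE !val_joint //; last exact: leq_trans (ltnW ij) jm.
by rewrite /= eqn_pmul2r // neq_ltn ij.
Qed.

Lemma joint_notin_inside i j l : (i <= m)%N -> (i <= j)%N || (l <= i)%N ->
  joint i \notin inside j l.
Proof. by move=> im H; rewrite inE val_joint // !ltn_pmul2r //; lia. Qed.

Lemma inside_joint j : (0 < j)%N -> (j < m)%N ->
  inside 0 j.+1 = joint j |: (inside 0 j :|: inside j j.+1).
Proof.
move=> j0 jm; have jk : (0 < j * k)%N by rewrite muln_gt0 j0.
by apply/setP => x; rewrite !inE -val_eqE val_joint ?(ltnW jm) //= mulSn mul0n; lia.
Qed.

Lemma card_inside j : (j < m)%N -> #|inside j j.+1| = k.-1.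
Proof.
move=> jm; have jmk : (j.+1 * k <= m * k)%N by rewrite leq_mul2r jm orbT.
by rewrite /inside card_ord_interval; move: jmk; rewrite mulSn; lia.
Qed.

Lemma clique_block j : (j < m)%N ->
  clique clique_ring (joint j |: (joint j.+1 |: inside j j.+1)).
Proof.
move=> jm x y xB yB xy; rewrite mem_clique_ring //.
apply/orP; left; apply/existsP; exists (Ordinal jm) => /=.
by move: xB yB; rewrite !inE -!val_eqE !val_joint ?(ltnW jm) //= mulSn; lia.
Qed.

(** No clique has vertices strictly on both sides of [j * k], and the apex, numbered above [m * k],
    belongs to neither set. *)
Lemma separated_blocks j : (0 < j)%N -> (j < m)%N ->
  separated clique_ring (joint 0 |: inside 0 j) (joint j.+1 |: inside j j.+1).
Proof.
move=> j0 jm x y xB yB.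
have jk : (0 < j * k)%N by rewrite muln_gt0 j0.
have jmk : (j.+1 * k <= m * k)%N by rewrite leq_mul2r jm orbT.
have [xj jy] : (x < j * k)%N /\ (j * k < y <= j.+1 * k)%N.
  by move: xB yB; rewrite !inE -!val_eqE !val_joint ?(ltnW jm) //= !mulSn; lia.
rewrite mem_clique_ring; last by rewrite -val_eqE /=; lia.
apply/negP => /or3P[/existsP[[i im] /= /andP[/andP[ix _] /andP[_ yi]]]|/andP[]|/andP[]].
- have [ji|ij] := leqP j i.
    have : (j * k <= i * k)%N by rewrite leq_mul2r ji orbT.
    lia.
  have : (i.+1 * k <= j * k)%N by rewrite leq_mul2r ij orbT.
  lia.
- by move: jmk; rewrite mulSn; lia.
- lia.
Qed.

Lemma disjoint_blocks j : (0 < j)%N -> (j < m)%N ->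
  [disjoint joint 0 |: inside 0 j & joint j.+1 |: inside j j.+1].
Proof.
move=> j0 jm; rewrite -setI_eq0; apply/eqP/setP => x.
rewrite !inE -!val_eqE !val_joint ?(ltnW jm) //=.
have jk : (0 < j * k)%N by rewrite muln_gt0 j0.
by rewrite mulSn; lia.
Qed.

Section Field.
Variables (R : fieldType) (q : R).
Hypothesis q0 : q != 0.
Local Notation zeta := (connected_sum clique_ring (q^-1 - 1)).
Local Notation split := (split_sum clique_ring (q^-1 - 1)).
Local Notation C := (clique_rel q k * q ^- 'C(k.+1, 2)).
Local Notation S := (clique_split q k.-1 * q ^- 'C(k.+1, 2)).

Lemma connected_sum_block j : (j < m)%N ->
  zeta (joint j |: (joint j.+1 |: inside j j.+1)) = C.
Proof.
move=> jm; have cB := clique_block jm.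
have j1 : joint j.+1 \notin inside j j.+1 by apply: joint_notin_inside => //; lia.
have j2 : joint j \notin joint j.+1 |: inside j j.+1.
  rewrite !inE negb_or joint_neq //.
  by have := @joint_notin_inside j j j.+1; rewrite inE; apply; lia.
rewrite (connected_sum_clique clique_ring_simple q0 j2 cB).
by rewrite cardsU1 j1 card_inside // add1n prednK.
Qed.

Lemma split_sum_block j : (j < m)%N ->
  split (joint j) (joint j.+1) (inside j j.+1) = S.
Proof.
move=> jm; rewrite split_sum_clique ?clique_ring_simple //.
- by rewrite card_inside // prednK.
- by apply: joint_notin_inside; lia.
- by apply: joint_notin_inside => //; lia.
- exact: clique_block.
Qed.

(** Each new block is attached at a cut vertex, so connected sums multiply and split sums obey the
    product rule, as for the derivative of a power. *)
Lemma connected_sum_chain j : (j < m)%N ->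
  zeta (joint 0 |: (joint j.+1 |: inside 0 j.+1)) = C ^+ j.+1 /\
  split (joint 0) (joint j.+1) (inside 0 j.+1) = j.+1%:R * C ^+ j * S.
Proof.
elim: j => [|j IH] jm.
  by rewrite connected_sum_block // split_sum_block // mul1r mul1r.
have [IH1 IH2] := IH (ltnW jm).
have cP : joint j.+1 \notin inside 0 j.+1 by apply: joint_notin_inside; lia.
have cQ : joint j.+1 \notin inside j.+1 j.+2 by apply: joint_notin_inside; lia.
have ac : joint 0 != joint j.+1 by apply: joint_neq; lia.
have ad : joint 0 != joint j.+2 by apply: joint_neq.
have cd : joint j.+1 != joint j.+2 by apply: joint_neq.
have dis := disjoint_blocks (ltn0Sn j) jm; have sep := separated_blocks (ltn0Sn j) jm.
rewrite inside_joint //; split.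
  have -> : joint 0 |: (joint j.+2 |: (joint j.+1 |: (inside 0 j.+1 :|: inside j.+1 j.+2))) =
      joint j.+1 |: ((joint 0 |: inside 0 j.+1) :|: (joint j.+2 |: inside j.+1 j.+2)).
    by rewrite setUACA [RHS]setUCA -setUA.
  rewrite connected_sum_cut_vertex ?clique_ring_simple //.
  - by rewrite setUCA IH1 connected_sum_block // [RHS]exprSr.
  - by rewrite !inE negb_or eq_sym ac; move: cP; rewrite inE.
  - by rewrite !inE negb_or cd; move: cQ; rewrite inE.
rewrite split_sum_series ?clique_ring_simple // IH1 IH2 split_sum_block //.
rewrite connected_sum_block // -[j.+2%:R]natr1.
move: C S => c s; rewrite exprS; ring.
Qed.

(** The ear formula is applied to the chain of [m] cliques with [t = q^-1]; its coefficients
    [t ^+ 2 - 1] and [(t - 1) ^+ 2] share the factor [1 - q] and the denominator [q ^+ 2]. *)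
Lemma Rel_clique_ring :
  Rel clique_ring q =
    q ^+ #|clique_ring| * q ^- ('C(k.+1, 2) * m + 2) * clique_rel q k ^+ m.-1 * (1 - q) *
    ((1 + q) * clique_rel q k + (1 - q) * m%:R * clique_split q k.-1).
Proof.
have := connected_sum_chain (j := m.-1); rewrite prednK // leqnn => /(_ isT) [H1 H2].
rewrite Rel_connected_sum //.
have -> : [set: 'I_N] = apex |: (joint 0 |: (joint m |: inside 0 m)).
  apply/setP => x; rewrite !inE -!val_eqE !val_joint //=.
  by have := ltn_ord x; rewrite ltnS; lia.
have a0 : apex != joint 0 by rewrite -val_eqE val_joint.
have am : apex != joint m by rewrite -val_eqE val_joint //=; lia.
rewrite connected_sum_ear ?clique_ring_simple ?joint_neq ?joint_notin_inside //; first last.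
- move=> x; rewrite inE => xi; rewrite mem_clique_ring; last first.
    by rewrite -val_eqE /=; lia.
  apply/negP => /or3P[/existsP[[i im] /=]|/andP[_]|/andP[/eqP]] /=; try lia.
  have imk : (i.+1 * k <= m * k)%N by rewrite leq_mul2r im orbT.
  by move: imk; rewrite mulSn; lia.
- by rewrite mem_clique_ring // /clique_ring_rel /= val_joint // !eqxx !orbT.
- by rewrite mem_clique_ring // /clique_ring_rel /= val_joint // !eqxx !orbT.
- by rewrite !inE !negb_or a0 am /=; lia.
  by rewrite leqnn orbT.
rewrite {}H1 {}H2 [(1 + _)%R]addrC subrK.
rewrite exprD exprM invfM -!exprVn -!mulrA; congr (_ * _).
have expm x : x ^+ m = x ^+ m.-1 * x :> R by rewrite -exprSr prednK.
move: (clique_rel q k) (clique_split q k.-1) (1 *+ m : R) => c s M.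
have qV : q * q^-1 = 1 by rewrite mulfV.
move: (q^-1) qV => v qv; move: ('C(k.+1, 2)) => b.
have -> : v - 1 = (1 - q) * v by rewrite mulrBl mul1r qv.
have -> : v ^+ 2 - 1 = (1 - q) * (1 + q) * v ^+ 2.
  transitivity (v ^+ 2 - (q * v) ^+ 2); first by rewrite qv expr1n.
  by ring.
rewrite !exprMn !expm; move: (v ^+ b) => u.
move: (u ^+ _) (c ^+ _) => w d; ring.
Qed.

End Field.

End CliqueRing.

(** * Sign changes and real roots *)

Lemma Rel_clique_ring_sign (R : realFieldType) (m k : nat) (a b : R) :
    (0 < m)%N -> (0 < k)%N -> a < 0 -> b < 0 ->
    0 < clique_rel a k -> 0 < clique_rel b k ->
    (1 + a) * clique_rel a k + (1 - a) * m%:R * clique_split a k.-1 < 0 ->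
    0 < (1 + b) * clique_rel b k + (1 - b) * m%:R * clique_split b k.-1 ->
  Rel (clique_ring m k) a * Rel (clique_ring m k) b < 0.
Proof.
move=> m0 k0 a0 b0 ca cb Da Db.
have [an0 bn0] : a != 0 /\ b != 0 by split; rewrite lt_eqF.
pose e := ('C(k.+1, 2) * m + 2)%N.
rewrite !Rel_clique_ring // -/e; set E := #|_|.
have ab0 : 0 < a * b by rewrite nmulr_rgt0.
set F := clique_rel a k ^+ _; set G := clique_rel b k ^+ _.
move: Da Db; set x := _ + _; set y := (1 + b) * _ + _ => x0 y0.
(* Both points are negative, so the powers pair up into powers of [a * b > 0] and the parities of
   the exponents do not affect the sign. *)
have -> : a ^+ E / a ^+ e * F * (1 - a) * x * (b ^+ E / b ^+ e * G * (1 - b) * y) =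
   (a * b) ^+ E * (a * b) ^- e * (F * G * ((1 - a) * (1 - b))) * (x * y).
  rewrite !exprMn invfM; clearbody F G x y.
  by move: (a ^+ E) (b ^+ E) (a ^- e) (b ^- e) => a' b' a'' b''; ring.
have xy0 : x * y < 0 by rewrite nmulr_rlt0.
rewrite pmulr_rlt0 //; apply: mulr_gt0; first by rewrite divr_gt0 ?exprn_gt0.
by rewrite !mulr_gt0 ?exprn_gt0 //; lra.
Qed.

(** For a disconnected graph the sum defining [Rel] is empty, so a nonzero value certifies
    connectedness. *)
Lemma clique_ring_connected (R : realFieldType) (m k : nat) (q : R) :
  Rel (clique_ring m k) q != 0 -> connectedb (clique_ring m k).
Proof.
apply: contraNT => nconn; apply/eqP; apply: big_pred0 => A; apply/negP.
rewrite powersetE => /andP[AE /andP[_ /forallP conn]].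
case/negP: nconn; apply/andP; split=> //; apply/forallP => x; apply/forallP => y.
by have /forallP/(_ y) := conn x; apply: connect_adj_mono.
Qed.

(* For [a < b < 0], a ring of [m] cliques with an even number [k.+1] of
   vertices has a root near the solution of [2 m q^k = -(1 + q) / (1 - q)], and
   the scales [a^k] and [b^k] separate as [k] grows. *)
Lemma clique_ring_sign_change (R : archiRealFieldType) (a b : R) :
    -1 < a -> a < b -> b < 0 ->
  exists m k : nat, Rel (clique_ring m k) a * Rel (clique_ring m k) b < 0.
Proof.
move=> a1 ab b0; have a0 : a < 0 by lra.
have [|pa Ha] := @clique_asymptotics _ a; first by rewrite ltr0_norm //; lra.
have [|pb Hb] := @clique_asymptotics _ b; first by rewrite ltr0_norm //; lra.
have ba0 : 0 <= b / a by rewrite -mulrNN -invrN divr_ge0; lra.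
(* The constant 48 is 3 * 16: with [m * A <= 3] below it gives [m * B <= (1 + b) / 16]. *)
have [||pc Hc] := @geometric_small _ (b / a) ((1 + b) / 48).
- by rewrite ba0 ltr_ndivrMr // mul1r.
- by lra.
(* Doubling makes [p.+1] odd, so the split sums, of the sign of [a ^+ p.+1] and [b ^+ p.+1], are
   negative. *)
pose p := (pa + pb + pc).*2.
have le_p : (pa + pb + pc <= p)%N by rewrite /p -addnn leq_addr.
have le_pa : (pa <= p)%N by apply: leq_trans le_p; rewrite -addnA leq_addr.
have le_pb : (pb <= p)%N by apply: leq_trans le_p; rewrite addnAC leq_addl.
have le_pc : (pc <= p.+1)%N by apply: leqW; apply: leq_trans le_p; rewrite leq_addl.
have [/andP[Ca1 Ca2] [ra /andP[ra1 ra3] Sa]] := Ha p le_pa.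
have [/andP[Cb1 Cb2] [rb /andP[rb1 rb3] Sb]] := Hb p le_pb.
have Hp := Hc p.+1 le_pc.
have odd_pow x : x ^+ p.+1 = - (- x) ^+ p.+1 :> R.
  by rewrite exprNn -signr_odd /= odd_double expr1 mulN1r opprK.
pose A := (- a) ^+ p.+1; pose B := (- b) ^+ p.+1.
have A0 : 0 < A by rewrite exprn_gt0 // oppr_gt0.
have B0 : 0 < B by rewrite exprn_gt0 // oppr_gt0.
have A1 : A <= 1 by rewrite exprn_ile1; lra.
have BA : B <= (1 + b) / 48 * A.
  rewrite -ler_pdivrMr // -expr_div_n; suff -> : - b / - a = b / a by [].
  by rewrite invrN mulrNN.
(* The least integer with [m * A > 2]; as [A <= 1], also [m * A <= 3]. *)
pose m := (Num.truncn (2 / A)).+1.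
have mA1 : 2 < m%:R * A by rewrite -ltr_pdivrMr // truncnS_gt.
have mA2 : m%:R * A <= 3.
  have : m%:R <= 2 / A + 1 by rewrite /m -natr1 lerD2r truncn_le divr_ge0 ?ltW.
  rewrite -(ler_pM2r A0) mulrDl divfK ?gt_eqF //; lra.
have mB : m%:R * B <= (1 + b) / 16.
  have : m%:R * B <= m%:R * ((1 + b) / 48 * A) by rewrite ler_wpM2l.
  by rewrite mulrCA; nra.
exists m, p.+1; apply: Rel_clique_ring_sign => //=; try lra.
(* At [a] the connected term is at most [2 * (1 + a) < 2], while the split term exceeds 2 in
   absolute value. *)
- rewrite Sa odd_pow -/A.
  have : ra * (m%:R * A) > 2 by nra.
  set z := ra * (m%:R * A) => z2.
  have -> : (1 - a) * m%:R * (ra * - A) = - ((1 - a) * z) by rewrite /z; ring.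
  nra.
(* At [b] the connected term is at least [(1 + b) / 2], while the split term is at most
   [3 * (1 + b) / 8] in absolute value. *)
rewrite Sb odd_pow -/B.
have : rb * (m%:R * B) <= 3 * (1 + b) / 16.
  have : 0 <= m%:R * B by rewrite mulr_ge0 // ltW.
  nra.
set z := rb * (m%:R * B) => z2.
have -> : (1 - b) * m%:R * (rb * - B) = - ((1 - b) * z) by rewrite /z; ring.
have : (1 - b) * z <= 2 * (3 * (1 + b) / 16).
  have : 0 <= z by rewrite /z !mulr_ge0 // ltW //; lra.
  nra.
nra.
Qed.

(** Instantiating [Rel] at the indeterminate yields the reliability polynomial itself, which gives
    access to [poly_ivt]. *)
Lemma Rel_horner (R : comNzRingType) n (E : {set {set 'I_n}}) (q : R) :
  (Rel E ('X : {poly R})).[q] = Rel E q.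
Proof. by rewrite horner_sum; apply: eq_bigr => A _; rewrite !hornerE. Qed.

Lemma Rel_root_between (R : rcfType) n (E : {set {set 'I_n}}) (a b : R) :
  a <= b -> Rel E a * Rel E b < 0 -> exists2 q, a <= q <= b & Rel E q = 0.
Proof.
(* Scaling by the value at [b] makes the polynomial negative at [a] and a square at [b], whichever
   way the sign changes. *)
move=> ab sgn; pose p : {poly R} := Rel E b *: Rel E 'X.
have pE q : p.[q] = Rel E b * Rel E q by rewrite hornerZ Rel_horner.
have b0 : Rel E b != 0 by apply: contraTneq sgn => ->; rewrite mulr0 ltxx.
have [|q qab] := @poly_ivt _ p a b ab.
  by rewrite !pE mulrC ltW //= -expr2 sqr_ge0.
by rewrite /root pE mulf_eq0 (negPf b0) /= => /eqP; exists q.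
Qed.

(** At 1 only the empty edge set could contribute, and it does not connect two vertices. *)
Lemma Rel_at1 (R : comNzRingType) n (E : {set {set 'I_n}}) :
  (1 < n)%N -> Rel E (1 : R) = 0.
Proof.
move=> n1; apply: big1 => A /andP[_ /andP[n0 /forallP conn]].
have [A0|A0] := eqVneq A set0; last first.
  by rewrite subrr expr0n cards_eq0 (negPf A0) mul0r.
have /forallP/(_ (Ordinal n1)) := conn (Ordinal n0).
move/(connect_adj_stable (U := [set Ordinal n0])); rewrite !inE eqxx => H.
suff : false by [].
by apply: H => // a b; rewrite /adj A0 inE andbF.
Qed.

Lemma complete2_connected : connectedb [set [set: 'I_2]].
Proof.
apply/andP; split=> //; apply/forallP => x; apply/forallP => y.
have [->//|xy] := eqVneq x y; apply: connect1; rewrite /adj xy inE eqEcard subsetT.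
by rewrite cardsT card_ord cards2 xy.
Qed.

(* The closure of the set of roots *)
From mathcomp Require Import all_classical all_reals all_analysis.
Import Order.TTheory GRing.Theory Num.Theory.
Import numFieldNormedType.Exports.
Local Open Scope classical_set_scope.
Local Open Scope ring_scope.

Lemma rel_roots_dense (R : realType) (x : R) :
  -1 <= x <= 0 -> closure (@rel_roots R) x.
Proof.
move=> /andP[x1 x0] B /nbhs_ballP[e /= e0 eB].
pose d := Num.min e 1 / 8.
have min0 : 0 < Num.min e 1 by rewrite lt_min e0 ltr01.
have d0 : 0 < d by rewrite divr_gt0.
have dle : 8 * d <= e by rewrite mulrC divfK // ge_min lexx.
have d1 : 8 * d <= 1 by rewrite mulrC divfK // ge_min lexx orbT.
suff [a [b [a1 ab b0 [xa bx]]]] : exists a b : R,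
    [/\ -1 < a, a < b, b < 0 & x - e < a /\ b < x + e].
  have [m [k sgn]] := clique_ring_sign_change a1 ab b0.
  have [q /andP[aq qb] q0] := Rel_root_between (ltW ab) sgn.
  exists q; split.
    exists _, (clique_ring m k); split=> //; first exact: clique_ring_simple.
    apply: (@clique_ring_connected _ m k b).
    by apply: contraTneq sgn => ->; rewrite mulr0 ltxx.
  by apply: eB; rewrite /ball /= ltr_norml; apply/andP; split; lra.
(* The interval is placed to the right of [x] in the left half of [-1, 0] and to the left otherwise;
   [8 * d <= 1] keeps it inside (-1, 0). *)
have [x2|x2] := ltP x (- 2^-1).
  by exists (x + d), (x + 2 * d); split; [lra|lra|lra|split; lra].
by exists (x - 2 * d), (x - d); split; [lra|lra|lra|split; lra].
Qed.

Theorem theorem1p1 (R : realType) :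
  closure (@rel_roots R) = `[-1, 0] `|` [set 1].
Proof.
apply/seteqP; split.
  have cl : closed (`[-1, 0] `|` [set (1 : R)]).
    by apply: closedU; [exact: itv_closed|exact: closed_eq].
  rewrite [X in _ `<=` X](closure_id _).1 //; apply: closure_subset.
  move=> q [n [E [sE conn q0]]].
  by have [|->] := Rel_root_range sE conn q0; [left; rewrite /= in_itv|right].
move=> x [|->]; first by rewrite /= in_itv; apply: rel_roots_dense.
(* The root 1 is attained by the complete graph on two vertices. *)
apply: subset_closure; exists 2%N, [set [set: 'I_2]%SET]%SET; split.
- by apply/forall_inP => e; rewrite inE => /eqP ->; rewrite cardsT card_ord.
- exact: complete2_connected.
- exact: Rel_at1.
Qed.
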